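(* Say that the weak isolation property holds at size $N$ if every dephased complex Hadamard matrix $H\in M_N(\mathbb C)$ which is regular and isolated is of Butson type (all entries roots of unity). Then: (1) the weak isolation property holds at $N=2,3,4,5,6$; (2) the weak isolation property holds at $N=7$, provided that every regular $7\times7$ complex Hadamard matrix is equivalent either to the Fourier matrix $F_7=(e^{2\pi\mathrm{i}jk/7})_{j,k=0}^{6}$ or to the Petrescu matrix $P_7^q$ for some $q\in\mathbb T$, where, with $w=e^{2\pi \mathrm{i}/6}$, $$P_7^q=\begin{pmatrix} -q&q&w&1&w&1&w\\ q&-q&w&1&1&w&w\\ w&w&-w&1&w&w&1\\ 1&1&1&-1&w&w&w\\ w&1&w&w&-\bar{q}w&\bar{q}w&1\\ 1&w&w&w&\bar{q}w&-\bar{q}w&1\\ w&w&1&w&1&1&-1 \end{pmatrix}.$$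
   Context: A complex Hadamard matrix is $H\in M_N(\mathbb C)$ with entries in the unit circle $\mathbb T$ and pairwise orthogonal rows. Two such matrices are equivalent if one passes from one to the other by permuting rows and columns and multiplying rows and columns by elements of $\mathbb T$. $H$ is dephased if its first row and column consist of $1$'s. A cycle is a formal sum $q(1+\zeta+\dots+\zeta^{n-1})$ with $q\in\mathbb T$, $\zeta=e^{2\pi\mathrm{i}/n}$; $H$ is regular if for all rows $i\ne j$ the multiset $\{H_{ik}\bar H_{jk}\}_k$ can be partitioned into cycles. A dephased $H$ is isolated if it is an isolated point of the set of dephased $N\times N$ complex Hadamard matrices. *)

(* Defs.v *)
From HB Require Import structures.
From mathcomp Require Import all_boot all_order all_algebra all_fingroup.
From mathcomp Require Import complex.
From mathcomp Require Import all_classical all_reals all_analysis.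
Set Implicit Arguments.
Unset Strict Implicit.
Unset Printing Implicit Defensive.
Import Order.TTheory GRing.Theory Num.Theory.
Import numFieldNormedType.Exports.
Local Open Scope ring_scope.

(* The library attaches the metric topology to an abstract numFieldType, but
   R[i] is a concrete type on which that inference does not fire. *)
HB.instance Definition _ (R : realType) :=
  PseudoPointedMetric.copy R[i] R[i]^o.
HB.instance Definition _ (R : realType) := NormedModule.copy R[i] R[i]^o.

(* e^{2 pi i / n} *)
Definition zeta (R : realType) (n : nat) : R[i] :=
  Complex (cos (2 * pi / n%:R)) (sin (2 * pi / n%:R)).

Definition complex_hadamard (R : realType) (N : nat) (H : 'M[R[i]]_N) : Prop :=
  (forall i j, `|H i j| = 1) /\
  (forall i j, i != j -> \sum_k H i k * (H j k)^* = 0).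

(* Permutations and unimodular rescalings of rows and columns form a group of
   transformations, each of which has the normal form below. *)
Definition hadamard_equiv (R : realType) (N : nat) (H K : 'M[R[i]]_N) : Prop :=
  exists (s t : 'S_N) (a b : 'I_N -> R[i]),
    [/\ forall i, `|a i| = 1, forall j, `|b j| = 1
      & forall i j, K i j = a i * H (s i) (t j) * b j].

Definition dephased (R : realType) (N : nat) (H : 'M[R[i]]_N) : Prop :=
  forall i j : 'I_N, i = 0%N :> nat \/ j = 0%N :> nat -> H i j = 1.

Definition dephased_hadamard (R : realType) (N : nat) : set 'M[R[i]]_N :=
  [set H | complex_hadamard H /\ dephased H]%classic.

(* The terms of the formal sum q (1 + z + ... + z^(n-1)), z = zeta R n. *)
Definition cycle_terms (R : realType) (c : R[i] * nat) : seq R[i] :=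
  [seq c.1 * zeta R c.2 ^+ k | k <- iota 0 c.2].

(* Cycles have length n >= 2: a one-term "cycle" q would not be a vanishing
   sum, and allowing it would make every matrix regular. *)
Definition is_cycle (R : realType) (c : R[i] * nat) : Prop :=
  `|c.1| = 1 /\ (2 <= c.2)%N.

Definition regular_mx (R : realType) (N : nat) (H : 'M[R[i]]_N) : Prop :=
  forall i j : 'I_N, i != j ->
  exists cs : seq (R[i] * nat),
    (forall c, c \in cs -> is_cycle c) /\
    perm_eq [seq H i k * (H j k)^* | k <- enum 'I_N]
            (flatten [seq cycle_terms c | c <- cs]).

Definition butson (R : realType) (N : nat) (H : 'M[R[i]]_N) : Prop :=
  forall i j, exists2 n, (0 < n)%N & n.-unity_root (H i j).

Definition weak_isolation (R : realType) (N : nat) : Prop :=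
  forall H : 'M[R[i]]_N,
    complex_hadamard H -> dephased H -> regular_mx H ->
    isolated (dephased_hadamard (R := R) (N := N)) H -> butson H.

Definition fourier_mx (R : realType) (N : nat) : 'M[R[i]]_N :=
  \matrix_(j < N, k < N) zeta R N ^+ (j * k).

Definition petrescu_rows (R : realType) (w q : R[i]) : seq (seq R[i]) :=
  let r := q^* in
  [:: [:: - q;   q;   w;   1;        w;        1;   w];
      [::   q; - q;   w;   1;        1;        w;   w];
      [::   w;   w; - w;   1;        w;        w;   1];
      [::   1;   1;   1; - 1;        w;        w;   w];
      [::   w;   1;   w;   w; - (r * w);   r * w;   1];
      [::   1;   w;   w;   w;    r * w; - (r * w);  1];
      [::   w;   w;   1;   w;        1;        1; - 1]].

(* The root of unity w is a parameter: these matrices are Hadamard for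
   w = zeta R 3, while for w = zeta R 6 any two of their rows have an inner
   product of modulus 2. *)
Definition petrescu_mx (R : realType) (w q : R[i]) : 'M[R[i]]_7 :=
  \matrix_(i < 7, j < 7) nth 0 (nth [::] (petrescu_rows w q) i) j.

(* Every regular complex Hadamard matrix of size 7 is, up to equivalence, the
   Fourier matrix or a Petrescu matrix built on w. *)
Definition regular7_classified (R : realType) (w : R[i]) : Prop :=
  forall H : 'M[R[i]]_7, complex_hadamard H -> regular_mx H ->
    hadamard_equiv H (fourier_mx R 7) \/
    exists2 q : R[i], `|q| = 1 & hadamard_equiv H (petrescu_mx w q).

(* Main.v *)
(** If a row product of H splits into cycles, its sum vanishes as soon as the
    ratios of its terms inside each cycle are kept, whatever the scalars in front
    of the cycles. These ratios are monomials in the entries of H whose values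
    are roots of unity. The exponents V in Q^(N x N) such that some integer
    multiple of V gives a monomial with value 1 at H form a rational subspace.
    If it is the whole space, all entries are roots of unity. Otherwise a nonzero
    rational linear form T vanishes on it, and the matrices H_ij e^(i s T_ij) are
    dephased Hadamard matrices that tend to H as s tends to 0, so that H is not
    isolated. *)

Require Import Defs.
From mathcomp Require Import all_boot all_order all_algebra.
From mathcomp Require Import complex.
From mathcomp Require Import all_classical all_reals all_analysis.
From mathcomp Require Import zify ring lra.
Set Implicit Arguments.
Unset Strict Implicit.
Unset Printing Implicit Defensive.
Import Order.TTheory GRing.Theory Num.Theory.
Import numFieldNormedType.Exports.
Local Open Scope classical_set_scope.
Local Open Scope ring_scope.

(** * Linear algebra and lifting of list partitions *)

(** Vectors of [P] are collected as rows of [A] until its row space is all of [P]. If [A] then lacks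
    full rank, its cokernel supplies the annihilating column. *)
Lemma subspace_annihilator (F : fieldType) (n : nat) (P : 'rV[F]_n -> Prop) :
  P 0 -> (forall a u v, P u -> P v -> P (a *: u + v)) ->
  (forall v, P v) \/
  exists2 t : 'cV[F]_n, t != 0 & forall v, P v -> v *m t = 0.
Proof.
move=> P0 Plin.
have Prow m (A : 'M[F]_(m, n)) v :
    (forall i, P (row i A)) -> (v <= A)%MS -> P v.
  move=> PA /submxP[D ->]; rewrite mulmx_sum_row.
  elim/big_rec: _ => // i u _ Pu; exact: Plin.
have [A PA maxA] : exists2 A : 'M[F]_n, forall i, P (row i A) &
    forall v, P v -> (v <= A)%MS.
  have [k rk] : exists k, (n - \rank (0%R : 'M[F]_n) <= k)%N.
    by exists n; rewrite leq_subr.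
  have : forall i, P (row i (0 : 'M[F]_n)) by move=> i; rewrite row0.
  move: (0 : 'M[F]_n) rk => A.
  (* Induction on a bound for the corank of [A]: each vector of [P] outside the row space raises the
     rank. *)
  elim: k A => [|k IHk] A rA PA.
    exists A => // v _; apply: submx_full; rewrite /row_full.
    by rewrite eqn_leq rank_leq_col -subn_eq0 -leqn0.
  have [maxA|/existsNP[v /not_implyP[Pv /negP vA]]] :=
    pselect (forall v, P v -> (v <= A)%MS); first by exists A.
  (* The sum is again a square matrix; its rows are combinations of [v] and the rows of [A], so they
     stay in [P]. *)
  apply: (IHk (A + <<v>>)%MS) => [|i]; last first.
    apply: (Prow _ (col_mx A v)).
      move=> j; case: (splitP j) => l jl.
        have -> : j = lshift 1 l by apply/val_inj.
        by rewrite rowKu.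
      have -> : j = rshift n l by apply/val_inj.
      by rewrite rowKd row_id.
    rewrite (submx_trans (row_sub _ _))// -addsmxE.
    by rewrite addsmxS// genmxE.
  have : (\rank A < \rank (A + <<v>>)%MS)%N.
    by apply: rank_ltmx; rewrite /ltmx addsmxSl addsmx_sub submx_refl genmxE.
  by move: rA; lia.
have [fullA|nfullA] := boolP (row_full A).
  by left=> v; apply: (Prow _ A) => //; apply: submx_full.
right; move: nfullA; rewrite -cokermx_eq0 => /eqP nz.
have [j nzj] : exists j, col j (cokermx A) != 0.
  apply/existsP; apply: contra_notT nz => /existsPn z.
  apply/matrixP=> i j; have /negPn/eqP/matrixP/(_ i ord0) := z j.
  by rewrite !mxE.
exists (col j (cokermx A)) => // v /maxA; rewrite submxE => /eqP vA0.
by rewrite colE mulmxA vA0 mul0mx.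
Qed.

(** Lifts a partition of values to one of their preimages. As [f] may take a value twice, the
    permutation is read on positions; the reordered list is then cut by the shape of [ts]. *)
Lemma perm_map_flatten (S T : eqType) (f : S -> T) (s : seq S)
    (ts : seq (seq T)) :
  perm_eq [seq f x | x <- s] (flatten ts) ->
  exists2 ss, perm_eq s (flatten ss) & [seq [seq f x | x <- s'] | s' <- ss] = ts.
Proof.
move=> sts.
have [s' ss' fs'] : exists2 s', perm_eq s s' & [seq f x | x <- s'] = flatten ts.
  case: s sts => [|x0 s] sts.
    by exists [::] => //; apply/esym/perm_nilP; rewrite perm_sym.
  move: sts; rewrite perm_sym => /(perm_iotaP (f x0))[Is pIs ->].
  exists [seq nth x0 (x0 :: s) i | i <- Is].
    rewrite perm_sym; apply/(perm_iotaP x0).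
    by exists Is => //; rewrite size_map in pIs.
  rewrite -map_comp; apply/eq_in_map => i iIs.
  rewrite /comp (nth_map x0)//.
  by have := perm_mem pIs i; rewrite iIs mem_iota size_map.
have szs' : size s' = sumn (shape ts).
  by rewrite -size_flatten -fs' size_map.
exists (reshape (shape ts) s').
  by rewrite reshapeKr// szs'.
by rewrite map_reshape fs' flattenK.
Qed.

(** * The unit circle *)

Definition cis (R : realType) (x : R) : R[i] := Complex (cos x) (sin x).

Lemma cis0 (R : realType) : cis 0 = 1 :> R[i].
Proof. by rewrite /cis cos0 sin0. Qed.

Lemma cisD (R : realType) (x y : R) : cis (x + y) = cis x * cis y.
Proof.
rewrite /cis cosD sinD; apply/eqP; rewrite eq_complex /=.
by rewrite eqxx [eqbRHS]addrC eqxx.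
Qed.

Lemma cisX (R : realType) (x : R) (n : nat) : cis x ^+ n = cis (x *+ n).
Proof.
by elim: n => [|n IHn]; rewrite ?expr0 ?mulr0n ?cis0// exprS mulrS cisD IHn.
Qed.

Lemma norm_cis (R : realType) (x : R) : `|cis x| = 1.
Proof. by rewrite normc_def /= cos2Dsin2 sqrtr1. Qed.

Lemma conj_cis (R : realType) (x : R) : (cis x)^* = cis (- x).
Proof. by rewrite /cis cosN sinN. Qed.

(** The real part is 1 - 2 sin^2(|x|/2), and |x|/2 lies strictly between 0 and pi. *)
Lemma cis_neq1 (R : realType) (x : R) : 0 < `|x| < 2 * pi -> cis x != 1.
Proof.
move=> /andP[x0 x2pi]; rewrite eq_complex negb_and /=.
have -> : cos x = cos `|x|.
  by case: (ger0P x) => _; rewrite ?cosN.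
have : 0 < sin (`|x| / 2) by apply: sin_gt0_pi; lra.
rewrite {2}(_ : `|x| = (`|x| / 2) *+ 2); last by rewrite -mulr_natr; lra.
rewrite cos_mulr2n cos2sin2 => s0; apply/orP; left; apply/eqP; nra.
Qed.

(** Since |1 - cis t|^2 = 2 - 2 cos t, the bound amounts to cos t > 1 - e^2/2, which continuity of
    the cosine at 0 gives. *)
Lemma near_cis1 (R : realType) (a : R) (e : R[i]) : 0 < e ->
  \forall s \near 0^'+, `|1 - cis (s * a)| < e.
Proof.
(* Positivity in [R[i]] forces the imaginary part of the radius to vanish. *)
case: e => e e'; rewrite ltcE /= => /andP[/eqP-> e0].
have ctn : continuous (@cos R \o *%R^~ a).
  move=> x; apply: continuous_comp; last exact: continuous_cos.
  exact: mulrr_continuous.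
have cvg1 : cos (s * a) @[s --> 0^'+] --> (1 : R).
  by apply: cvg_at_right_filter; have := ctn 0; rewrite /continuous_at /= mul0r cos0.
have lt1 : 1 - e ^+ 2 / 2 < 1 by rewrite gtrBl divr_gt0// exprn_gt0.
near=> s; have gt_cos : 1 - e ^+ 2 / 2 < cos (s * a).
  by near: s; apply: cvgr_gt cvg1 _ lt1.
rewrite normc_def ltcR /= sub0r sqrrN.
have -> : (1 - cos (s * a)) ^+ 2 + sin (s * a) ^+ 2 = 2 - 2 * cos (s * a).
  by rewrite sin2cos2; ring.
rewrite -[ltRHS](ger0_norm (ltW e0)) -sqrtr_sqr ltr_sqrt ?exprn_gt0//.
by move: gt_cos; lra.
Unshelve. all: by end_near. Qed.

(** * Roots of unity and cycles *)

Lemma zeta_cis (R : realType) (n : nat) : zeta R n = cis (2 * pi / n%:R).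
Proof. by []. Qed.

Lemma zeta_expn (R : realType) (n : nat) : (0 < n)%N -> zeta R n ^+ n = 1.
Proof.
move=> n0; rewrite zeta_cis cisX -[_ *+ n]mulr_natr divfK ?pnatr_eq0 -?lt0n//.
by rewrite /cis mulr_natl cos2pi sin2pi.
Qed.

Lemma zeta_neq1 (R : realType) (n : nat) : (1 < n)%N -> zeta R n != 1.
Proof.
move=> n1; apply: cis_neq1; have n0 : (0 : R) < n%:R by rewrite ltr0n ltnW.
have p0 := pi_gt0 R.
rewrite ger0_norm; last by rewrite divr_ge0// ?ltW// mulr_gt0.
rewrite divr_gt0 ?mulr_gt0//= ltr_pdivrMr// ltr_pMr ?mulr_gt0//.
by rewrite ltr1n.
Qed.

Lemma sum_cycle_terms (R : realType) (c : R[i] * nat) :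
  is_cycle c -> \sum_(z <- cycle_terms c) z = 0.
Proof.
case=> _ c2; rewrite /cycle_terms big_map -mulr_sumr.
have -> : iota 0 c.2 = index_iota 0 c.2 by rewrite /index_iota subn0.
rewrite big_mkord.
have := subrX1 (zeta R c.2) c.2; rewrite zeta_expn ?(ltnW c2)// subrr.
move=> /esym/eqP; rewrite mulf_eq0 subr_eq0 (negPf (zeta_neq1 R c2)) /=.
by move=> /eqP ->; rewrite mulr0.
Qed.

Lemma cycle_terms_expn (R : realType) (c : R[i] * nat) (z : R[i]) :
  is_cycle c -> z \in cycle_terms c -> z ^+ c.2 = c.1 ^+ c.2.
Proof.
move=> [_ c2] /mapP[k _ ->].
by rewrite exprMn exprAC zeta_expn ?expr1n ?mulr1// ltnW.
Qed.

(** * Monomials in the entries and torsion exponents *)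

Definition monomial (F : fieldType) (m n : nat) (H : 'M[F]_(m, n))
    (W : 'M[int]_(m, n)) : F :=
  \prod_i \prod_j H i j ^ W i j.

Lemma monomialD (F : fieldType) (m n : nat) (H : 'M[F]_(m, n))
    (U W : 'M[int]_(m, n)) : (forall i j, H i j != 0) ->
  monomial H (U + W) = monomial H U * monomial H W.
Proof.
move=> Hnz; rewrite /monomial -big_split; apply: eq_bigr => i _.
by rewrite -big_split; apply: eq_bigr => j _; rewrite mxE expfzDr.
Qed.

Lemma monomialZ (F : fieldType) (m n : nat) (H : 'M[F]_(m, n)) (a : int)
    (W : 'M[int]_(m, n)) :
  monomial H (a *: W) = monomial H W ^ a.
Proof.
have expM := big_morph (fun x : F => x ^ a) (fun x y => expfzMl x y a)
  (exp1rz F a).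
rewrite /monomial expM; apply: eq_bigr => i _; rewrite expM.
by apply: eq_bigr => j _; rewrite mxE mulrC exprz_exp.
Qed.

Lemma monomial_delta (F : fieldType) (m n : nat) (H : 'M[F]_(m, n)) i j :
  monomial H (delta_mx i j) = H i j.
Proof.
rewrite /monomial (bigD1 i)//= (bigD1 j)//= !mxE !eqxx expr1z.
rewrite !big1 ?mulr1// => [k ki|k kj].
  by apply: big1 => l _; rewrite mxE (negPf ki) expr0z.
by rewrite mxE eqxx (negPf kj) expr0z.
Qed.

(** Fractional powers have no canonical value, so [d] both clears the denominators of [V] and
    absorbs the order of the resulting root of unity. *)
Definition torsion (F : fieldType) (m n : nat) (H : 'M[F]_(m, n))
    (V : 'M[rat]_(m, n)) : Prop :=
  exists2 d, (0 < d)%N &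
  exists2 W : 'M[int]_(m, n), d%:R *: V = map_mx intr W & monomial H W = 1.

Lemma torsion0 (F : fieldType) (m n : nat) (H : 'M[F]_(m, n)) : torsion H 0.
Proof.
exists 1%N => //; exists 0; first by rewrite map_mx0 scaler0.
by rewrite -(scale0r 0) monomialZ expr0z.
Qed.

Lemma torsion_lin (F : fieldType) (m n : nat) (H : 'M[F]_(m, n)) (a : rat)
    (U V : 'M[rat]_(m, n)) : (forall i j, H i j != 0) ->
  torsion H U -> torsion H V -> torsion H (a *: U + V).
Proof.
move=> Hnz [d d0 [W dU HW]] [e e0 [X eV HX]].
pose q := `|denq a|%N.
have qa : q%:R * a = (numq a)%:~R by rewrite numqE mulrC -absz_denq.
have q0 : (0 < q)%N by rewrite absz_gt0 denq_neq0.
(* With q a = [numq a], one has q d e (a U + V) = (numq a) e (d U) + q d (e V). *)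
exists (q * d * e)%N; first by rewrite !muln_gt0 q0 d0.
exists ((numq a * e%:Z) *: W + (q * d)%:Z *: X); last first.
  by rewrite monomialD// !monomialZ HW HX !exp1rz mulr1.
rewrite map_mxD !map_mxZ -dU -eV scalerDr !scalerA; congr (_ *: _ + _ *: _).
  by rewrite !natrM rmorphM/= -qa; ring.
by rewrite natrM.
Qed.

Lemma torsion_delta (F : fieldType) (m n : nat) (H : 'M[F]_(m, n)) i j :
  torsion H (delta_mx i j) <-> exists2 d, (0 < d)%N & H i j ^+ d = 1.
Proof.
split=> -[d d0]; last first.
  move=> Hd; exists d => //; exists (d%:Z *: delta_mx i j).
    by rewrite map_mxZ map_delta_mx.
  by rewrite monomialZ monomial_delta.
move=> [W dW HW]; exists d => //.
have -> : H i j ^+ d = monomial H (d%:Z *: delta_mx i j).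
  by rewrite monomialZ monomial_delta.
rewrite -HW; congr monomial; apply/matrixP => k l.
move/matrixP: dW => /(_ k l); rewrite !mxE -natrM -mulrz_nat.
by move=> /intr_inj <-; rewrite !natz PoszM.
Qed.

(** The exponent is that of the ratio of two terms of a row product, conjugation being inversion on
    the unit circle. Equal [d]-th powers make this ratio a root of unity. *)
Lemma torsion_quotients (F : fieldType) (m n : nat) (H : 'M[F]_(m, n))
    (d : nat) i j k l : (forall i j, H i j != 0) -> (0 < d)%N ->
  (H i k / H j k) ^+ d = (H i l / H j l) ^+ d ->
  torsion H (delta_mx i k - delta_mx j k - (delta_mx i l - delta_mx j l)).
Proof.
move=> Hnz d0 eqd; exists d => //.
exists (d%:Z *: (delta_mx i k - delta_mx j k - (delta_mx i l - delta_mx j l))).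
  by rewrite map_mxZ !map_mxB !map_delta_mx.
rewrite monomialZ -!scaleN1r !monomialD// !monomialZ !monomialD// !monomialZ.
rewrite !monomial_delta -!invr_expz !expr1z -exprnP exprMn exprVn eqd divff//.
by rewrite expf_neq0// mulf_neq0// invr_eq0.
Qed.

(** * Deformation of a regular matrix *)

(** Moves the cycles from values to column indices, keeping two facts about each: its sum vanishes
    and its terms share an [n]-th power. *)
Lemma regular_blocks (R : realType) (N : nat) (H : 'M[R[i]]_N) (i j : 'I_N) :
  regular_mx H -> i != j ->
  exists2 ss : seq (seq 'I_N), perm_eq (enum 'I_N) (flatten ss) &
  forall s, s \in ss -> \sum_(k <- s) H i k * (H j k)^* = 0 /\
  exists2 n, (0 < n)%N & {in s &, forall k l,
    (H i k * (H j k)^*) ^+ n = (H i l * (H j l)^*) ^+ n}.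
Proof.
move=> reg /reg[cs [cyc /perm_map_flatten[ss pss sscs]]].
exists ss => // s sss.
have /mapP[c ccs sE] : [seq H i k * (H j k)^* | k <- s] \in
    [seq cycle_terms c | c <- cs] by rewrite -sscs; apply/mapP; exists s.
have cycc := cyc _ ccs; split.
  rewrite -(big_map (fun k => H i k * (H j k)^*) xpredT id) sE.
  exact: sum_cycle_terms.
exists c.2; first by case: cycc => _ /ltnW.
have sc k : k \in s -> (H i k * (H j k)^*) ^+ c.2 = c.1 ^+ c.2.
  by move=> ks; apply: cycle_terms_expn => //; rewrite -sE; apply: map_f.
by move=> k l /sc -> /sc ->.
Qed.

Lemma unimodular_conj (C : numClosedFieldType) (z : C) : `|z| = 1 -> z^* = z^-1.
Proof. by move=> z1; rewrite invC_norm z1 expr1n invr1 mul1r. Qed.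

Lemma weak_isolation_all (R : realType) (N : nat) : weak_isolation R N.
Proof.
move=> H [H1 Horth] deph reg [_ [V nV VA]].
have Hnz i j : H i j != 0 by rewrite -normr_eq0 H1 oner_eq0.
have [||all_torsion|[t /eqP tnz ann]] :=
  @subspace_annihilator rat (N * N) (fun v => torsion H (vec_mx v)).
- by rewrite linear0; apply: torsion0.
- by move=> a u v Hu Hv; rewrite linearP; apply: torsion_lin.
- move=> i j; have := all_torsion (mxvec (delta_mx i j)).
  rewrite mxvecK => /torsion_delta[d d0 Hd]; exists d => //.
  by apply/unity_rootP.
(* The annihilating column [t] in matrix coordinates, and the linear form [phi] it defines. *)
pose T i j := t (mxvec_index i j) 0.
pose phi (U : 'M[rat]_N) := (mxvec U *m t) 0 0.
have phi0 U : torsion H U -> phi U = 0.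
  by move=> HU; rewrite /phi ann ?mxE// mxvecK.
have phiB U W : phi (U - W) = phi U - phi W.
  by rewrite /phi linearB mulmxBl !mxE.
have phi_delta i j : phi (delta_mx i j) = T i j.
  by rewrite /phi mxvec_delta -rowE mxE.
pose M s := \matrix_(i, j) (H i j * cis (s * ratr (T i j))).
have dephM s : dephased (M s).
  (* An entry equal to 1 has a torsion matrix unit, so [T] vanishes there and the entry stays
     fixed. *)
  move=> i j ij0; rewrite mxE deph// -phi_delta phi0.
    by rewrite rmorph0 mulr0 cis0 mulr1.
  by apply/torsion_delta; exists 1%N; rewrite // deph.
have hadM s : complex_hadamard (M s).
  split=> [i j|i j ij]; first by rewrite mxE normrM H1 norm_cis mulr1.
  have [ss pss blocks] := regular_blocks reg ij.
  rewrite -big_enum (perm_big _ pss)/= big_flatten big_seq big1// => b /blocks.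
  move=> [sum0 [n n0 eqn]].
  case: b => [|l b] in sum0 eqn *; first by rewrite big_nil.
  (* On a block all phase factors agree with that of the first column [l], so they factor out of a
     vanishing sum. *)
  have constT k : k \in l :: b -> T i k - T j k = T i l - T j l.
    move=> kb; rewrite -!phi_delta -!phiB; apply/eqP; rewrite -subr_eq0 -phiB.
    apply/eqP/phi0/(torsion_quotients (d := n)) => //.
    by rewrite -!unimodular_conj//; apply: eqn; rewrite ?mem_head.
  rewrite big_seq; transitivity (\sum_(k <- l :: b | k \in l :: b)
      H i k * (H j k)^* * cis (s * ratr (T i l - T j l))).
    apply: eq_bigr => k /constT <-; rewrite !mxE rmorphM/= conj_cis.
    by rewrite mulrACA -cisD rmorphB mulrBr.
  by rewrite -big_seq -mulr_suml sum0 mul0r.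
have nearV : \forall s \near (0 : R)^'+, V (M s).
  move/nbhs_ballP: nV => [e /= e0 eV].
  near=> s; apply: eV; split=> // i j.
  rewrite /ball /= mxE -{1}(mulr1 (H i j)) -mulrBr normrM H1 mul1r.
  move: i j; near: s; apply: filter_forall => i; apply: filter_forall => j.
  exact: near_cis1.
have [i [j Tij]] : exists i j, T i j != 0.
  apply: contra_notP tnz => /forallNP T0; apply/matrixP => k l.
  rewrite ord1 mxE; case/mxvec_indexP: k => i j.
  by have /forallNP/(_ j)/negP/negPn/eqP := T0 i.
have p2 : 0 < 2 * pi :> R by rewrite mulr_gt0// pi_gt0.
have Tij0 : 0 < `|ratr (T i j)| :> R by rewrite normr_gt0 fmorph_eq0.
(* Here [s] is small enough for [M s] to lie in [V], and the phase at (i, j) is nonzero and below a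
   full turn, so [M s] differs from [H]. *)
have [s [Vs s0 s2pi]] : exists s,
    [/\ V (M s), 0 < s & s * `|ratr (T i j)| < 2 * pi].
  near (0 : R)^'+ => s; exists s; split; [by near: s|by []|].
  by rewrite -ltr_pdivlMr//; near: s; apply: nbhs_right_lt; rewrite divr_gt0.
have : ([set H] (M s))%classic by rewrite -VA; split.
move=> /matrixP/(_ i j); rewrite mxE -[RHS]mulr1 => /(mulfI (Hnz i j)) cis1.
have := @cis_neq1 R (s * ratr (T i j)); rewrite cis1 eqxx normrM gtr0_norm//.
by rewrite s2pi mulr_gt0// => /(_ isT).
Unshelve. all: by end_near. Qed.

Theorem theorem2p11 (R : realType) :
  (forall N : nat, (2 <= N <= 6)%N -> weak_isolation R N) /\
  (regular7_classified (zeta R 6) -> weak_isolation R 7) /\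
  (regular7_classified (zeta R 3) -> weak_isolation R 7).
Proof. by do ?split => *; apply: weak_isolation_all. Qed.
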